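(* Let $T = (T_1,\ldots,T_n) \in \mathcal{B}(\mathcal{H})^n$ be a pure commuting contractive tuple on a Hilbert space $\mathcal{H}$, let $\Pi_c : \mathcal{H} \to H^2_n(\mathcal{E}_c)$ be the canonical (Arveson) dilation of $T$, and let $\Pi : \mathcal{H} \to H^2_n(\mathcal{E})$ be a dilation of $T$. Then there exists an isometry $V \in \mathcal{B}(\mathcal{E}_c,\mathcal{E})$ such that $$\Pi = (I_{H^2_n} \otimes V)\,\Pi_c .$$
   Context: All Hilbert spaces are complex. A commuting tuple $T=(T_1,\ldots,T_n)$ of bounded operators on $\mathcal{H}$ is a contractive tuple (row contraction) if $P_T(I_{\mathcal{H}}) \le I_{\mathcal{H}}$, where $P_T(X) = \sum_{i=1}^n T_i X T_i^*$ for $X \in \mathcal{B}(\mathcal{H})$. A row contraction is pure if $P_T^m(I_{\mathcal{H}}) \to 0$ in the strong operator topology as $m\to\infty$. $H^2_n$ is the Drury-Arveson space, i.e. the reproducing kernel Hilbert space of analytic functions on the open unit ball $\mathbb{B}^n \subset \mathbb{C}^n$ with kernel $(1-\sum_{i=1}^n z_i\bar w_i)^{-1}$. For a Hilbert space $\mathcal{E}$, $H^2_n(\mathcal{E})$ is the $\mathcal{E}$-valued reproducing kernel Hilbert space with kernel $(1-\sum_{i=1}^n z_i\bar w_i)^{-1} I_{\mathcal{E}}$, identified with $H^2_n \otimes \mathcal{E}$; $M_{z_i}$ denotes multiplication by the $i$-th coordinate function on it. An isometry $\Gamma : \mathcal{H} \to H^2_n(\mathcal{E})$, with $\mathcal{E}$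 a Hilbert space, is a dilation of $T$ if $M_{z_i}^*\Gamma = \Gamma T_i^*$ for $i=1,\ldots,n$. The canonical (Arveson) dilation of a pure commuting contractive tuple $T$ is the dilation $\Pi_c : \mathcal{H} \to H^2_n(\mathcal{E}_c)$ given by $\mathcal{E}_c = \overline{\mathrm{ran}}(I_{\mathcal{H}} - P_T(I_{\mathcal{H}}))$, $D = (I_{\mathcal{H}} - P_T(I_{\mathcal{H}}))^{1/2}$ and $$(\Pi_c h)(z) = D\Big(I_{\mathcal{H}} - \sum_{i=1}^n z_i T_i^*\Big)^{-1} h \qquad (z \in \mathbb{B}^n,\ h \in \mathcal{H}).$$ *)

(* Defs.v *)
From HB Require Import structures.
From mathcomp Require Import all_boot all_order all_algebra complex.
From mathcomp Require Import all_classical all_reals.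
From mathcomp Require Import topology normedtype sequences.
From mathcomp Require Import ring lra.

Set Implicit Arguments.
Unset Strict Implicit.
Unset Printing Implicit Defensive.

Import Order.TTheory GRing.Theory Num.Theory.
Import numFieldNormedType.Exports.

Local Open Scope classical_set_scope.
Local Open Scope ring_scope.

HB.mixin Record CompleteNormedModule_isHilbert (R : realType) V
    & CompleteNormedModule R[i] V := {
  (* linear in the first variable, conjugate-linear in the second *)
  hdot : {dot V for Num.conj};
  hdotE : forall x : V, hdot x x = `|x| ^+ 2 }.

#[short(type="hilbertType")]
HB.structure Definition Hilbert (R : realType) :=
  {V of CompleteNormedModule R[i] V & CompleteNormedModule_isHilbert R V}.

Notation "''[' u , v ]" := (hdot u v) : ring_scope.

Section HilbertTheory.
Variables (R : realType) (H : hilbertType R).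
Implicit Types x y z : H.

Lemma hdotDl x y z : '[x + y, z] = '[x, z] + '[y, z].
Proof. exact: linearDl. Qed.
Lemma hdotZl (a : R[i]) x y : '[a *: x, y] = a * '[x, y].
Proof. exact: linearZl_LR. Qed.
Lemma hdotC x y : '[x, y] = ('[y, x])^*.
Proof. by rewrite (@hermitian_subproof _ _ _ _ hdot x y) expr0 mul1r. Qed.
Lemma hdotDr x y z : '[x, y + z] = '[x, y] + '[x, z].
Proof. exact: linearDr. Qed.
Lemma hdotZr (a : R[i]) x y : '[x, a *: y] = a^* * '[x, y].
Proof. exact: linearZr_LR. Qed.
Lemma hdotNl x y : '[- x, y] = - '[x, y].
Proof. by rewrite -scaleN1r hdotZl mulN1r. Qed.
Lemma hdotNr x y : '[x, - y] = - '[x, y].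
Proof. by rewrite hdotC hdotNl rmorphN/= -hdotC. Qed.
Lemma hdotBl x y z : '[x - y, z] = '[x, z] - '[y, z].
Proof. by rewrite hdotDl hdotNl. Qed.
Lemma hdotBr x y z : '[x, y - z] = '[x, y] - '[x, z].
Proof. by rewrite hdotDr hdotNr. Qed.
Lemma hdot0l x : '[0, x] = 0.
Proof. by rewrite -(scale0r x) hdotZl mul0r. Qed.
Lemma hdot0r x : '[x, 0] = 0.
Proof. by rewrite hdotC hdot0l conjC0. Qed.

Lemma hdot_inj x y : (forall z, '[z, x] = '[z, y]) -> x = y.
Proof.
move=> xy; apply/subr0_eq/eqP; rewrite -normr_eq0 -sqrf_eq0 -hdotE.
by rewrite hdotBr xy subrr.
Qed.

Lemma hCauchySchwarz x y : `| '[x, y] | <= `|x| * `|y|.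
Proof.
have [->|y0] := eqVneq y 0; first by rewrite hdot0r !normr0 mulr0.
have ny0 : 0 < `|y| by rewrite normr_gt0.
rewrite -(@ler_pXn2r _ 2) ?nnegrE ?mulr_ge0// exprMn.
set a := '[x, y] / `|y| ^+ 2.
have aE : a * `|y| ^+ 2 = '[x, y] by rewrite divfK// expf_neq0// gt_eqF.
have : 0 <= '[x - a *: y, x - a *: y] by rewrite hdotE exprn_ge0.
rewrite hdotBl !hdotBr !hdotZl !hdotZr !hdotE (hdotC y x).
rewrite (mulrCA a) aE (mulrC a^*) opprB addrA addrNK subr_ge0 /a.
by rewrite mulrAC -normCK ler_pdivrMr ?exprn_gt0.
Qed.

Lemma hparallelogram x y :
  `|x + y| ^+ 2 + `|x - y| ^+ 2 = (`|x| ^+ 2 + `|y| ^+ 2) *+ 2.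
Proof.
rewrite -!hdotE hdotBl hdotDl !hdotBr !hdotDr; ring.
Qed.

End HilbertTheory.


Record bop (R : realType) (H K : hilbertType R) := Bop {
  bop_fun :> {linear H -> K};
  bop_continuous : continuous bop_fun }.

Notation "''B(' H , K )" := (bop H K) (format "''B(' H ,  K )") : type_scope.
Notation "''B(' H )" := 'B(H, H) (format "''B(' H )") : type_scope.

Lemma bopP (R : realType) (H K : hilbertType R) (A B : 'B(H, K)) :
  A =1 B -> A = B.
Proof.
case: A B => [A cA] [B cB] /= AB.
have eAB : A = B.
  case: A B AB {cA cB} => [A [[a] [b]]] [B [[a'] [b']]] /= /funext AB.
  by subst B; rewrite (Prop_irrelevance a a') (Prop_irrelevance b b').
by subst B; congr Bop; exact: Prop_irrelevance.
Qed.

HB.instance Definition _ (R : realType) (H K : hilbertType R) :=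
  gen_eqMixin 'B(H, K).
HB.instance Definition _ (R : realType) (H K : hilbertType R) :=
  gen_choiceMixin 'B(H, K).

Section BopAlgebra.
Variables (R : realType) (H K : hilbertType R).
Implicit Types A B C : 'B(H, K).

Definition bop_zero : 'B(H, K).
Proof. by exists (\0 : {linear H -> K}) => x; exact: cst_continuous. Defined.

Definition bop_opp A : 'B(H, K).
Proof.
exists (\- A : {linear H -> K}) => x.
by apply: cvgN; exact: bop_continuous.
Defined.

Definition bop_add A B : 'B(H, K).
Proof.
exists (A \+ B : {linear H -> K}) => x.
by apply: cvgD; exact: bop_continuous.
Defined.

Definition bop_scale (a : R[i]) A : 'B(H, K).
Proof.
exists (a \*: A : {linear H -> K}) => x.
by apply: cvgZl_tmp; exact: bop_continuous.
Defined.

Fact bop_addA : associative bop_add.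
Proof. by move=> A B C; apply: bopP => x /=; rewrite addrA. Qed.
Fact bop_addC : commutative bop_add.
Proof. by move=> A B; apply: bopP => x /=; rewrite addrC. Qed.
Fact bop_add0 : left_id bop_zero bop_add.
Proof. by move=> A; apply: bopP => x /=; rewrite add0r. Qed.
Fact bop_addN : left_inverse bop_zero bop_opp bop_add.
Proof. by move=> A; apply: bopP => x /=; rewrite addNr. Qed.

HB.instance Definition _ :=
  GRing.isZmodule.Build 'B(H, K) bop_addA bop_addC bop_add0 bop_addN.

Fact bop_scaleA a b A : bop_scale a (bop_scale b A) = bop_scale (a * b) A.
Proof. by apply: bopP => x /=; rewrite scalerA. Qed.
Fact bop_scale1 : left_id 1 bop_scale.
Proof. by move=> A; apply: bopP => x /=; rewrite scale1r. Qed.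
Fact bop_scaleDr : right_distributive bop_scale +%R.
Proof. by move=> a A B; apply: bopP => x /=; rewrite scalerDr. Qed.
Fact bop_scaleDl A a b :
  bop_scale (a + b) A = bop_scale a A + bop_scale b A.
Proof. by apply: bopP => x /=; rewrite scalerDl. Qed.

HB.instance Definition _ :=
  GRing.Zmodule_isLmodule.Build R[i] 'B(H, K)
    bop_scaleA bop_scale1 bop_scaleDr bop_scaleDl.

Lemma bop0E x : (0 : 'B(H, K)) x = 0. Proof. by []. Qed.
Lemma bopDE A B x : (A + B) x = A x + B x. Proof. by []. Qed.
Lemma bopNE A x : (- A) x = - A x. Proof. by []. Qed.
Lemma bopBE A B x : (A - B) x = A x - B x. Proof. by []. Qed.
Lemma bopZE a A x : (a *: A) x = a *: A x. Proof. by []. Qed.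
Lemma bop_sumE I (r : seq I) (P : pred I) (F : I -> 'B(H, K)) x :
  (\sum_(i <- r | P i) F i) x = \sum_(i <- r | P i) F i x.
Proof. by elim/big_ind2 : _ => // A a B b <- <-. Qed.

End BopAlgebra.

Definition bop_id (R : realType) (H : hilbertType R) : 'B(H).
Proof. by exists (idfun : {linear H -> H}) => x; exact: cvg_id. Defined.

Notation "\1" := (bop_id _) : ring_scope.

Definition bop_comp (R : realType) (H K L : hilbertType R)
  (A : 'B(K, L)) (B : 'B(H, K)) : 'B(H, L).
Proof.
exists (A \o B : {linear H -> L}) => x.
by apply: continuous_comp; exact: bop_continuous.
Defined.

Notation "A \Bo B" := (bop_comp A B)
  (at level 40, left associativity, format "A  \Bo  B") : ring_scope.

Lemma bop_bounded (R : realType) (H K : hilbertType R) (A : 'B(H, K)) :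
  exists2 M : R[i], 0 <= M & forall x, `|A x| <= M * `|x|.
Proof.
have /linear_bounded_continuous/linear_boundedP := @bop_continuous _ _ _ A.
by move=> /pinfty_ex_gt0 [M /ltW M0 AM]; exists M.
Qed.

Lemma bop_of_bound (R : realType) (H K : hilbertType R) (f : {linear H -> K})
  (M : R[i]) : 0 <= M -> (forall x, `|f x| <= M * `|x|) -> continuous f.
Proof.
move=> M0 fM; apply/linear_bounded_continuous/bounded_funP => r.
exists (M * r) => x xr; apply: le_trans (fM x) _; exact: ler_wpM2l.
Qed.

Definition adj (R : realType) (H K : hilbertType R) (A : 'B(H, K)) :
    'B(K, H) :=
  xget 0 [set B : 'B(K, H) | forall x y, '[A x, y] = '[x, B y]].



Section Riesz.
Variables (R : realType) (H : hilbertType R) (phi : {linear H -> R[i]^o}).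
Hypothesis phiC : continuous phi.

Let nsq (x : H) : R := complex.Re (`|x| ^+ 2).

Let nsqE x : `|x| ^+ 2 = (nsq x)%:C%C.
Proof. by rewrite RRe_real// ger0_real// exprn_ge0. Qed.

Let nsq_ge0 x : 0 <= nsq x.
Proof. by rewrite -lecR -nsqE exprn_ge0. Qed.

Let S := [set x | phi x = 1].

Let minS : S !=set0 -> exists2 u, S u & forall x, S x -> `|u| <= `|x|.
Proof.
move=> S0.
pose d := inf (nsq @` S).
have lbd : has_lbound (nsq @` S) by exists 0 => _ [x _ <-].
have hi : has_inf (nsq @` S).
  by split=> //; case: S0 => x Sx; exists (nsq x), x.
have dle x : S x -> d <= nsq x by move=> Sx; apply: ge_inf => //; exists x.
pose B (e : R) := [set x | S x /\ nsq x < d + e].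
pose F : set_system H := filter_from [set e : R | 0 < e] B.
have FF : ProperFilter F.
  apply: filter_from_proper; last first.
    move=> e /= e0; have [_ [x Sx <-] xe] := inf_adherent e0 hi.
    by exists x.
  apply: filter_from_filter; first by exists 1 => /=.
  move=> e e' /= e0 e'0; exists (Num.min e e') => /=.
    by rewrite lt_min e0.
  move=> x [Sx]; rewrite -ltrBlDl lt_min !ltrBlDl => /andP[xe xe'].
  by split.
have Bd e x y : 0 < e -> B e x -> B e y -> nsq (x - y) < e * 4.
  move=> e0 [Sx xe] [Sy ye].
  have Sm : S ((2^-1 : R[i]) *: (x + y)).
    rewrite /S /= linearZ/= linearD/= Sx Sy.
    by rewrite /GRing.scale/= -[1 + 1]/(2 : R[i]) mulVf// pnatr_eq0.
  have := dle _ Sm.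
  have -> : nsq ((2^-1 : R[i]) *: (x + y)) = nsq (x + y) / 4.
    apply: complexI; rewrite -nsqE normrZ exprMn nsqE rmorphM/=.
    rewrite fmorphV/= rmorph_nat normfV normr_nat mulrC.
    by congr (_ * _); field.
  have : nsq (x + y) + nsq (x - y) = (nsq x + nsq y) *+ 2.
    by apply: complexI; rewrite rmorphD/= rmorphMn/= rmorphD/= -!nsqE hparallelogram.
  lra.
have Fc : cauchy F.
  apply/cauchy_ballP => e e0; 
  have [r r0 re] : exists2 r : R, 0 < r & e = r%:C%C.
    exists (complex.Re e); last by rewrite RRe_real// gtr0_real.
    by rewrite -ltcR RRe_real// gtr0_real.
  have e'0 : 0 < r ^+ 2 / 4 by rewrite divr_gt0// exprn_gt0.
  exists (B (r ^+ 2 / 4), B (r ^+ 2 / 4)) => /=; first by split; exists (r ^+ 2 / 4).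
  move=> [x y] /= [Bx By]; rewrite -ball_normE /=.
  rewrite -(@ltr_pXn2r _ 2) ?nnegrE// ?(ltW e0)// nsqE re -rmorphXn/= ltcR.
  by have := Bd _ _ _ e'0 Bx By; lra.
have : cvg F by exact: cauchy_cvg.
set u := lim F => Fu.
have cl (A : set H) : closed A -> (exists2 e, 0 < e & B e `<=` A) -> A u.
  move=> cA [e e0 BA]; apply: cA => V Vu.
  have [e' e'0 BV] := Fu _ Vu.
  have : F (B e `&` B e') by apply: filterI; [exists e|exists e'].
  move=> /filter_ex[x [Bx /BV Vx]]; exists x; split=> //; exact: BA.
exists u.
  apply: (cl S); last by exists 1 => // x [].
  have -> : S = phi @^-1` [set (1 : R[i]^o)] by [].
  apply: closed_comp => [x _|]; first exact: phiC.
  apply: accessible_closed_set1; apply: hausdorff_accessible.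
  exact: norm_hausdorff.
move=> x Sx; rewrite -(@ler_pXn2r _ 2) ?nnegrE// !nsqE lecR.
apply/ler_addgt0Pr => e e0; apply: le_trans (_ : d + e <= _); last first.
  by rewrite lerD2r dle.
have sqr0 : 0 <= (Num.sqrt (d + e))%:C%C :> R[i] by rewrite lecR sqrtr_ge0.
have de0 : 0 <= d + e.
  by rewrite addr_ge0// ?(ltW e0)// lb_le_inf//; [case: hi|move=> _ [y _ <-]].
rewrite -(sqr_sqrtr de0) -lecR -nsqE rmorphXn/= ler_pXn2r ?nnegrE//.
apply: (cl [set y | `|y| <= (Num.sqrt (d + e))%:C%C :> R[i]]).
  move=> y cy /=.
  have [//|] := real_leP (normr_real y) (ger0_real sqr0).
  rewrite -subr_gt0 => /(nbhsx_ballx y)/cy[z [/= zr]].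
  rewrite -ball_normE/= ltrBrDr => yz.
  have := ler_normD (y - z) z; rewrite subrK => h.
  by have := le_lt_trans (le_trans h (lerD (lexx _) zr)) yz; rewrite ltxx.
exists e => // y [_ ye] /=.
by rewrite -(@ler_pXn2r _ 2) ?nnegrE// nsqE -rmorphXn/= sqr_sqrtr// lecR ltW.
Qed.

Lemma riesz : exists y, forall x, phi x = '[x, y].
Proof.
have [phi0|/existsNP[w /eqP phiw]] := pselect (forall x, phi x = 0).
  by exists 0 => x; rewrite phi0 hdot0r.
have [|u Su umin] := minS.
  exists ((phi w)^-1 *: w); rewrite /S/= linearZ/=.
  by rewrite /GRing.scale/= mulVf.
have ortho k : phi k = 0 -> '[k, u] = 0.
  move=> phik; apply/eqP; have [->|k0] := eqVneq k 0; first by rewrite hdot0l.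
  have nk0 : 0 < `|k| ^+ 2 by rewrite exprn_gt0// normr_gt0.
  pose a := '[u, k] / `|k| ^+ 2.
  have /umin : S (u - a *: k) by rewrite /S/= linearB/= linearZ/= phik scaler0 subr0.
  rewrite -(@ler_pXn2r _ 2) ?nnegrE// -!hdotE.
  have aE : a * '[k, k] = '[u, k] by rewrite hdotE divfK// gt_eqF.
  rewrite hdotBl !hdotBr !hdotZl !hdotZr (hdotC k u).
  rewrite (mulrCA a) aE (mulrC a^*) opprB addrA addrNK.
  rewrite -subr_ge0 addrAC subrr sub0r oppr_ge0 /a mulrAC -normCK.
  rewrite pmulr_lle0 ?invr_gt0// => h.
  have : `|'[u, k]| ^+ 2 == 0 by rewrite eq_le h exprn_ge0.
  by rewrite sqrf_eq0 normr_eq0 conjC_eq0.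
have u0 : '[u, u] != 0.
  rewrite hdotE sqrf_eq0 normr_eq0; apply/eqP => u0.
  by move: Su; rewrite /S/= u0 linear0 => /esym/eqP; rewrite oner_eq0.
have cuu : ('[u, u])^* = '[u, u] by rewrite -hdotC.
exists (('[u, u])^-1 *: u) => x.
have : '[x - phi x *: u, u] = 0.
  apply: ortho; rewrite linearB/= linearZ/= Su.
  by rewrite /GRing.scale/= mulr1 subrr.
rewrite hdotBl hdotZl => /subr0_eq xu.
by rewrite hdotZr fmorphV/= cuu xu mulrCA mulVf// mulr1.
Qed.

End Riesz.

(* packs a linearity proof as a {linear _ -> _} *)
Definition lin_of (F : nzRingType) (U V : lmodType F) (f : U -> V)
  (L : linear f) := f.

HB.instance Definition _ (F : nzRingType) (U V : lmodType F) (f : U -> V)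
    (L : linear f) :=
  GRing.isLinear.Build F U V *:%R (lin_of L) L.

Lemma adjP (R : realType) (H K : hilbertType R) (A : 'B(H, K)) x y :
  '[A x, y] = '[x, adj A y].
Proof.
rewrite /adj; case: xgetP => [B _ //|/= noB]; exfalso.
have /choice[B AB] y' : exists z, forall x', '[A x', y'] = '[x', z].
  have L : linear (fun x => '[A x, y'] : R[i]^o).
    by move=> a u v; rewrite linearD linearZ hdotDl hdotZl.
  pose phi : {linear H -> R[i]^o} := lin_of L.
  have [M M0 AM] := bop_bounded A.
  apply: (@riesz _ _ phi); apply/linear_bounded_continuous/bounded_funP => r.
  exists (M * r * `|y'|) => x' xr; apply: le_trans (hCauchySchwarz _ _) _.
  by rewrite ler_wpM2r// (le_trans (AM x'))// ler_wpM2l.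
have L : linear B.
  move=> a u v; apply: hdot_inj => z.
  by rewrite -AB !hdotDr !hdotZr -!AB.
pose B' : {linear K -> H} := lin_of L.
have [M M0 AM] := bop_bounded A.
have cB : continuous B'.
  apply: (@bop_of_bound _ _ _ _ M) => // y'; change (`|B y'| <= M * `|y'|).
  have [->|B0] := eqVneq (B y') 0; first by rewrite normr0 mulr_ge0.
  rewrite -(ler_pM2r (_ : 0 < `|B y'|)) ?normr_gt0// -expr2 -hdotE -AB.
  rewrite -[leLHS]ger0_norm; last by rewrite AB hdotE exprn_ge0.
  apply: le_trans (hCauchySchwarz _ _) _.
  by rewrite mulrAC ler_wpM2r.
exact: (noB (Bop cB)) => x' y'; rewrite /= AB.
Qed.

Lemma adjE (R : realType) (H K : hilbertType R) (A : 'B(H, K)) (B : 'B(K, H)) :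
  (forall x y, '[A x, y] = '[x, B y]) -> adj A = B.
Proof.
by move=> AB; apply: bopP => y; apply: hdot_inj => z; rewrite -adjP AB.
Qed.

Section ComplexHilbert.
Variable R : realType.

Fact complex_complete (F : set_system R[i]^o) :
  ProperFilter F -> cauchy F -> cvg F.
Proof.
move=> FF Fc.
have part (p : R[i] -> R) : (forall x y, `|p x - p y|%:C%C <= `|x - y|) ->
    exists l : R, forall e, 0 < e -> \forall x \near F, `|l - p x| < e.
  move=> pn.
  have : cvg (fmap (p : R[i]^o -> R) F).
    apply: cauchy_cvg; apply/cauchyP => e e0.
    have eC0 : 0 < e%:C%C :> R[i] by rewrite ltcR.
    have [x Fx] := (cauchyP F).1 Fc _ eC0.
    exists (p x); rewrite /fmap/=.
    apply: (@filterS _ F _ (ball (x : R[i]^o) e%:C%C)) => // y.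
    rewrite -!ball_normE /= => xy.
    by rewrite -ltcR; exact: le_lt_trans (pn _ _) xy.
  set l := lim _ => pl; exists l => e e0.
  have /cvgrPdist_lt := pl; exact.
have [a Fa] : exists l : R, forall e, 0 < e ->
    \forall x \near F, `|l - complex.Re x| < e.
  apply: part => -[x x'] [y y'] /=; rewrite -[leRHS]/(_%:C%C) lecR.
  by rewrite -sqrtr_sqr ler_wsqrtr// lerDl sqr_ge0.
have [b Fb] : exists l : R, forall e, 0 < e ->
    \forall x \near F, `|l - complex.Im x| < e.
  apply: part => -[x x'] [y y'] /=; rewrite -[leRHS]/(_%:C%C) lecR.
  by rewrite -sqrtr_sqr ler_wsqrtr// lerDr sqr_ge0.
apply/cvg_ex; exists (a +i* b)%C; apply/cvgrPdist_lt => e e0.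
have [r r0 ->] : exists2 r : R, 0 < r & e = r%:C%C.
  exists (complex.Re e); last by rewrite RRe_real// gtr0_real.
  by rewrite -ltcR RRe_real// gtr0_real.
have r20 : 0 < r / 2 by rewrite divr_gt0.
apply: filterS2 (Fa _ r20) (Fb _ r20) => -[x y] /= ax bY.
have -> : (a +i* b)%C - (x +i* y)%C =
    (a - x)%:C%C + 'i%C * (b - y)%:C%C by simpc.
apply: le_lt_trans (ler_normD _ _) _.
rewrite normrM !normc_def /= !expr0n /= expr1n add0r sqrtr1 mul1r.
rewrite !addr0 !sqrtr_sqr.
by rewrite -rmorphD ltcR; lra.
Qed.

(* C as a Hilbert space over itself; a fresh name because the canonical
   completeness instance of _^o is the one of R^o *)
Definition hilbertC := R[i]^o.
HB.instance Definition _ := NormedModule.copy hilbertC R[i]^o.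
HB.instance Definition _ := Uniform_isComplete.Build hilbertC complex_complete.

Definition cdot (x y : hilbertC) : R[i] := x * y^*.

Fact cdot_bilinear : bilinear_for *%R (Num.conj \; *%R) cdot.
Proof.
split=> [y a u v|x a u v]; rewrite /cdot /GRing.scale/=.
- by rewrite mulrDl mulrA.
- by rewrite rmorphD rmorphM/= mulrDr mulrCA.
Qed.

Fact cdot_herm x y : cdot x y = (-1) ^+ false * (cdot y x)^*.
Proof. by rewrite expr0 mul1r /cdot rmorphM/= conjCK mulrC. Qed.

Fact cdot_gt0 x : x != 0 -> 0 < cdot x x.
Proof. by move=> x0; rewrite /cdot -normCK exprn_gt0// normr_gt0. Qed.

HB.instance Definition _ :=
  bilinear_isBilinear.Build R[i] hilbertC hilbertC R[i] *%R (Num.conj \; *%R) cdot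
    cdot_bilinear.
HB.instance Definition _ :=
  isHermitianSesquilinear.Build R[i] hilbertC false Num.conj cdot cdot_herm.
HB.instance Definition _ := isDotProduct.Build R[i] hilbertC cdot cdot_gt0.

Fact cdotE (x : hilbertC) : cdot x x = `|x| ^+ 2.
Proof. by rewrite /cdot -normCK. Qed.

HB.instance Definition _ :=
  CompleteNormedModule_isHilbert.Build R hilbertC cdotE.

End ComplexHilbert.


Section ClosedRange.
Variables (R : realType) (H K : hilbertType R) (A : 'B(H, K)).

Definition cran_set : {pred K} := [pred x | `[< closure (range A) x >]].

Fact cran_submod : submod_closed cran_set.
Proof.
split; first by rewrite inE; apply: subset_closure; exists 0; rewrite ?linear0.
move=> a u v; rewrite !inE => Au Av B /nbhs_ballP[e /= e0 eB].
have a1 : 0 < `|a| + 1 by rewrite ltr_wpDl.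
have d0 : 0 < e / 2 / (`|a| + 1) by rewrite !divr_gt0.
have e20 : 0 < e / 2 by rewrite divr_gt0.
have [_ [[x _ <-]]] := Au _ (nbhsx_ballx u _ d0); rewrite -ball_normE/= => ux.
have [_ [[y _ <-]]] := Av _ (nbhsx_ballx v _ e20); rewrite -ball_normE/= => vy.
exists (A (a *: x + y)); split; first by exists (a *: x + y).
apply: eB; rewrite -ball_normE/= linearP opprD addrACA -scalerBr.
apply: le_lt_trans (ler_normD _ _) _; rewrite normrZ [ltRHS]splitr.
apply: ler_ltD vy; apply: le_trans (_ : `|a| * (e / 2 / (`|a| + 1)) <= _).
  by rewrite ler_wpM2l// ltW.
rewrite mulrCA ger_pMr// ler_pdivrMr// mul1r lerDl ler01//.
Qed.

HB.instance Definition _ :=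
  GRing.isSubmodClosed.Build R[i] K cran_set cran_submod.

(* the closure of the range of A, as a Hilbert space *)
Record cran : predArgType := Cran { cran_val : K; _ : cran_val \in cran_set }.

HB.instance Definition _ := [isSub for cran_val].
HB.instance Definition _ := [Choice of cran by <:].
HB.instance Definition _ := [SubChoice_isSubLmodule of cran by <:].

Definition cran_norm (x : cran) : R[i] := `|val x|.

Fact cran_ler_normD x y : cran_norm (x + y) <= cran_norm x + cran_norm y.
Proof. by rewrite /cran_norm raddfD ler_normD. Qed.
Fact cran_normrZ (a : R[i]) x : cran_norm (a *: x) = `|a| * cran_norm x.
Proof. by rewrite /cran_norm linearZ normrZ. Qed.
Fact cran_normr0_eq0 x : cran_norm x = 0 -> x = 0.
Proof. by move=> /normr0_eq0 x0; apply: val_inj; rewrite x0 raddf0. Qed.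

HB.instance Definition _ := Lmodule_isNormed.Build R[i] cran
  cran_ler_normD cran_normrZ cran_normr0_eq0.

Lemma cran_normE (x : cran) : `|x| = `|val x|. Proof. by []. Qed.

Fact cran_complete (F : set_system cran) :
  ProperFilter F -> cauchy F -> cvg F.
Proof.
move=> FF Fc.
have : cvg (fmap (val : cran -> K) F).
  apply: cauchy_cvg; apply/cauchyP => e e0.
  have [x Fx] := (cauchyP F).1 Fc _ e0.
  exists (val x); rewrite /fmap/=.
  apply: (@filterS _ F _ (ball x e)) => // y.
  by rewrite -!ball_normE /= cran_normE raddfB.
set l := lim _ => Fl.
have lA : l \in cran_set.
  rewrite inE; apply: (@closed_closure _ (range A)) => B Bl.
  have FB : F (val @^-1` B) := Fl _ Bl.
  have [x Bx] := filter_ex FB.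
  by exists (val x); split=> //; have := valP x; rewrite inE.
apply/cvg_ex; exists (Cran lA); apply/cvgrPdist_lt => e e0.
have : F (val @^-1` (ball l e)) by apply: Fl; exact: nbhsx_ballx.
by apply: filterS => x; rewrite -ball_normE/= cran_normE raddfB.
Qed.

HB.instance Definition _ := Uniform_isComplete.Build cran cran_complete.

Definition cran_dot (x y : cran) : R[i] := '[val x, val y].

Fact cran_dot_bilinear : bilinear_for *%R (Num.conj \; *%R) cran_dot.
Proof.
split=> [y a u v|x a u v]; rewrite /cran_dot [val (_ + _)]linearP.
- by rewrite hdotDl hdotZl.
- by rewrite hdotDr hdotZr.
Qed.

Fact cran_dot_herm x y : cran_dot x y = (-1) ^+ false * (cran_dot y x)^*.
Proof. by rewrite expr0 mul1r /cran_dot hdotC. Qed.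

Fact cran_dotE x : cran_dot x x = `|x| ^+ 2.
Proof. by rewrite /cran_dot hdotE. Qed.

Fact cran_dot_gt0 x : x != 0 -> 0 < cran_dot x x.
Proof. by move=> x0; rewrite cran_dotE exprn_gt0// normr_gt0. Qed.

HB.instance Definition _ :=
  bilinear_isBilinear.Build R[i] cran cran R[i] *%R (Num.conj \; *%R) cran_dot
    cran_dot_bilinear.
HB.instance Definition _ :=
  isHermitianSesquilinear.Build R[i] cran false Num.conj cran_dot cran_dot_herm.
HB.instance Definition _ := isDotProduct.Build R[i] cran cran_dot cran_dot_gt0.

HB.instance Definition _ :=
  CompleteNormedModule_isHilbert.Build R cran cran_dotE.

End ClosedRange.

(* The E-valued reproducing kernel Hilbert space over X with kernel K I_E: a
   Hilbert space of functions X -> E (its elements are identified with functions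
   by the injective evaluation) containing the functions K(., w) eta, which
   reproduce the evaluations. It is unique up to the unitary that preserves the
   underlying functions. *)
Record rkhs (R : realType) (X : Type) (E : hilbertType R)
    (K : X -> X -> R[i]) := Rkhs {
  rkhs_space :> hilbertType R;
  rkhs_eval : X -> {linear rkhs_space -> E};
  rkhs_eval_inj : forall F G : rkhs_space,
    (forall z, rkhs_eval z F = rkhs_eval z G) -> F = G;
  rkhs_kernel : X -> E -> rkhs_space;
  rkhs_kernelE : forall w eta z,
    rkhs_eval z (rkhs_kernel w eta) = K z w *: eta;
  rkhs_reproducing : forall (F : rkhs_space) w eta,
    '[F, rkhs_kernel w eta] = '[rkhs_eval w F, eta] }.

Arguments rkhs_eval {R X E K r} z.

(* the Euclidean ball; the library norm on row vectors is the sup norm *)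
Record unit_ball (R : realType) (n : nat) := UnitBall {
  ball_point :> 'rV[R[i]]_n;
  ball_pointP : \sum_i `|ball_point 0 i| ^+ 2 < 1 }.

Definition da_kernel (R : realType) (n : nat) (z w : unit_ball R n) : R[i] :=
  (1 - \sum_i z 0 i * (w 0 i)^*)^-1.

(* H^2_n(E); H^2_n itself is the case E = hilbertC R *)
Definition drury_arveson (R : realType) (n : nat) (E : hilbertType R) :=
  rkhs E (@da_kernel R n).

Section Operators.
Variables (R : realType) (H K : hilbertType R).

Definition isometric (A : 'B(H, K)) := forall x, `|A x| = `|x|.

(* over C, '[A x, x] being real for all x forces A to be self-adjoint *)
Definition bop_le (A B : 'B(H)) := forall x, 0 <= '[(B - A) x, x].

Definition bop_sqrt (A D : 'B(H)) := bop_le 0 D /\ D \Bo D = A.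

Definition bop_inverse (A B : 'B(H)) := A \Bo B = \1 /\ B \Bo A = \1.

End Operators.

Section Tuples.
Variables (R : realType) (n : nat) (H : hilbertType R) (T : 'I_n -> 'B(H)).

Definition P_map (X : 'B(H)) : 'B(H) := \sum_i T i \Bo X \Bo adj (T i).

Definition commuting_tuple := forall i j, T i \Bo T j = T j \Bo T i.

Definition row_contraction := bop_le (P_map \1) \1.

(* strong operator convergence of the powers of P_T, applied to I, to 0 *)
Definition pure_tuple :=
  forall h : H, (iter m P_map \1) h @[m --> \oo] --> (0 : H).

Definition defect : 'B(H) := \1 - P_map \1.

Definition defect_space : hilbertType R := cran defect.

End Tuples.

Section Dilations.
Variables (R : realType) (n : nat) (H : hilbertType R) (T : 'I_n -> 'B(H)).

(* M is the operator M_{z_i} *)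
Definition coordinate_mult (E : hilbertType R) (HE : drury_arveson n E)
    (i : 'I_n) (M : 'B(HE)) :=
  forall (F : HE) z, rkhs_eval z (M F) = z 0 i *: rkhs_eval z F.

Definition dilation (E : hilbertType R) (HE : drury_arveson n E)
    (Gamma : 'B(H, HE)) :=
  isometric Gamma /\
  forall i, exists2 M : 'B(HE), coordinate_mult i M &
    adj M \Bo Gamma = Gamma \Bo adj (T i).

Definition canonical_dilation (HE : drury_arveson n (defect_space T))
    (Gamma : 'B(H, HE)) :=
  exists2 D : 'B(H), bop_sqrt (defect T) D &
  forall z : unit_ball R n,
    exists2 Q : 'B(H), bop_inverse (\1 - \sum_i z 0 i *: adj (T i)) Q &
    forall h, cran_val (rkhs_eval z (Gamma h)) = D (Q h).

End Dilations.

Section Tensor.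
Variables (R : realType) (n : nat) (Hs : drury_arveson n (hilbertC R)).

(* F is f (x) eta under the identification of H^2_n(E) with H^2_n (x) E *)
Definition elementary_tensor (E : hilbertType R) (HE : drury_arveson n E)
    (f : Hs) (eta : E) (F : HE) :=
  forall z, rkhs_eval z F = (rkhs_eval z f : R[i]) *: eta.

(* W is I (x) V; as elementary tensors are total, this determines W *)
Definition id_tensor (E E' : hilbertType R) (HE : drury_arveson n E)
    (HE' : drury_arveson n E') (V : 'B(E, E')) (W : 'B(HE, HE')) :=
  forall (f : Hs) (eta : E), exists2 F : HE,
    elementary_tensor f eta F & elementary_tensor f (V eta) (W F).

End Tensor.

(* Main.v *)
(** In the Drury-Arveson space, [I - sum_i M_i M_i^*] is the projection onto the
    constants, which reads [F(z) - sum_i z_i (M_i^* F)(z) = F(0)] pointwise. For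
    a dilation [Pi] this gives [<(Pi h)(0), (Pi k)(0)> = <h, k> - sum_i <T_i^* h,
    T_i^* k> = <D h, D k>], so that [D h |-> (Pi h)(0)] extends to an isometry
    [V], and, with [h = g - sum_i z_i T_i^* g], also [(Pi h)(z) = (Pi g)(0) =
    V D g = V (Pi_c h)(z)]. The operator [I (x) V] acts on kernel functions by
    [k_w eta |-> k_w (V eta)]; both isometries are obtained from the equality of
    the Gram matrices of two families, the first of which is total. *)

Require Import Defs.
From HB Require Import structures.
From mathcomp Require Import all_boot all_order all_algebra complex.
From mathcomp Require Import all_classical all_reals.
From mathcomp Require Import topology normedtype sequences.
From mathcomp Require Import ring lra.

Set Implicit Arguments.
Unset Strict Implicit.
Unset Printing Implicit Defensive.

Import Order.TTheory GRing.Theory Num.Theory.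
Import numFieldNormedType.Exports.

Local Open Scope classical_set_scope.
Local Open Scope ring_scope.

(** * Polarization and positive operators *)

Section HilbertBasics.
Variables (R : realType) (H : hilbertType R).
Implicit Types (x y z : H) (A B : 'B(H)).

Lemma hdot_suml I (r : seq I) (F : I -> H) y :
  '[\sum_(i <- r) F i, y] = \sum_(i <- r) '[F i, y].
Proof.
by elim/big_rec2: _ => [|i a b _ <-]; rewrite ?hdot0l// hdotDl.
Qed.

Lemma hdot_sumr I (r : seq I) (F : I -> H) y :
  '[y, \sum_(i <- r) F i] = \sum_(i <- r) '[y, F i].
Proof.
by elim/big_rec2: _ => [|i a b _ <-]; rewrite ?hdot0r// hdotDr.
Qed.

Lemma hnorm_eq (K : hilbertType R) x (y : K) :
  '[x, x] = '[y, y] -> `|x| = `|y|.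
Proof.
rewrite !hdotE => /eqP; rewrite eqrXn2// => /eqP//.
Qed.

(** Polarization: the form of [A - B] is antisymmetric by testing on [x + y] and symmetric by
    testing on ['i *: x + y], hence zero. *)
Lemma quadratic_form_inj A B : (forall x, '[A x, x] = '[B x, x]) -> A = B.
Proof.
move=> AB; apply/eqP; rewrite -subr_eq0; apply/eqP.
have {AB} q x : '[(A - B) x, x] = 0 by rewrite bopBE hdotBl AB subrr.
have s x y : '[(A - B) x, y] + '[(A - B) y, x] = 0.
  by have := q (x + y); rewrite (linearD (A - B)) hdotDl !hdotDr !q add0r addr0.
apply: bopP => x; apply: hdot_inj => y; rewrite bop0E hdot0r hdotC.
have := s ('i *: x) y; rewrite (linearZ_LR (A - B)) hdotZl hdotZr conjCi mulNr => /subr0_eq.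
move=> /(mulfI (neq0Ci _)) e; have := s x y; rewrite -e => /eqP.
by rewrite -mulr2n mulrn_eq0/= => /eqP->; rewrite conjC0.
Qed.

(** Since ['[A x, x]] is real, [A] and [adj A] have the same quadratic form. *)
Lemma bop_ge0_selfadjoint A : bop_le 0 A -> forall x y, '[A x, y] = '[x, A y].
Proof.
move=> A0 x y; rewrite adjP; congr ('[_, _]).
suff -> : adj A = A by [].
apply: quadratic_form_inj => {}x.
rewrite hdotC -adjP; apply/CrealP/ger0_real.
by have := A0 x; rewrite subr0.
Qed.

Lemma isometric_hdot (K : hilbertType R) (G : 'B(H, K)) :
  isometric G -> forall x y, '[G x, G y] = '[x, y].
Proof.
move=> Gi x y; rewrite adjP; congr ('[_, _]).
have e : adj G \Bo G = \1.
  by apply: quadratic_form_inj => z; rewrite hdotC -adjP !hdotE Gi -hdotE -hdotC.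
exact: (congr1 (fun B : 'B(H) => B y) e).
Qed.

Lemma adjPr (K : hilbertType R) (A : 'B(K, H)) x (y : K) :
  '[x, A y] = '[adj A x, y].
Proof. by rewrite hdotC adjP -hdotC. Qed.

End HilbertBasics.

(** * Completeness and real-valued squared norms *)

(** Cantor intersection for sets that need not be closed: the [B e] generate a Cauchy filter, whose
    limit is only adherent to them. *)
Lemma nested_limit (R : realType) (H : hilbertType R) (B : R -> set H) :
  (forall e, 0 < e -> B e !=set0) ->
  (forall e e', 0 < e -> e <= e' -> B e `<=` B e') ->
  (forall d, 0 < d -> exists2 e, 0 < e &
    forall x y, B e x -> B e y -> `|x - y| < d%:C%C) ->
  exists u, forall e d, 0 < e -> 0 < d -> exists2 x, B e x & `|u - x| < d%:C%C.
Proof.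
move=> B0 Bmon Bsmall.
pose F : set_system H := filter_from [set e : R | 0 < e] B.
have FF : ProperFilter F.
  apply: filter_from_proper => //; apply: filter_from_filter.
    by exists 1 => /=.
  move=> e e' /= e0 e'0; have m0 : 0 < Num.min e e' by rewrite lt_min e0.
  by exists (Num.min e e') => // x Bx; split; apply: Bmon Bx => //;
    rewrite ge_min lexx ?orbT.
have Fc : cauchy F.
  apply/cauchy_ballP => e e0.
  have er : e = (complex.Re e)%:C%C by rewrite RRe_real// gtr0_real.
  have [|d d0 Bd] := Bsmall (complex.Re e); first by rewrite -ltcR -er.
  exists (B d, B d) => /=; first by split; exists d.
  by move=> [x y] /= [Bx By]; rewrite -ball_normE /= er; exact: Bd.
have Fu : cvg F by exact: cauchy_cvg.
exists (lim F) => e d e0 d0.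
have dC : 0 < d%:C%C :> R[i] by rewrite ltcR.
have [e' e'0 BV] := Fu _ (nbhsx_ballx _ _ dC).
have : F (B e `&` B e') by apply: filterI; [exists e|exists e'].
by move=> /filter_ex[x [Bx /BV]]; rewrite -ball_normE => Vx; exists x.
Qed.

Lemma le_small_eq0 (R : realType) (z M : R[i]) : 0 <= z -> 0 <= M ->
  (forall d : R, 0 < d -> z <= d%:C%C * M) -> z = 0.
Proof.
move=> z0 M0 zM.
have zE : z = (complex.Re z)%:C%C by rewrite RRe_real// ger0_real.
have ME : M = (complex.Re M)%:C%C by rewrite RRe_real// ger0_real.
move: z0 M0 zM; rewrite zE ME => {zE ME}.
move: (complex.Re z) (complex.Re M) => {}z {}M; rewrite !lecR => z0 M0 zM.
apply: (congr1 (fun r => r%:C%C)); apply/eqP; rewrite eq_le z0 andbT.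
have M1 : 0 < M + 1 by rewrite ltr_wpDl.
apply/ler_addgt0Pr => e e0; rewrite add0r.
have := zM (e / (M + 1)); rewrite divr_gt0// => /(_ isT).
rewrite -rmorphM lecR => /le_trans; apply.
by rewrite mulrAC ler_pdivrMr// ler_pM2l// lerDl ler01.
Qed.

(** Norms take values in [R[i]]; a value in [R] gives access to infima and to [lra]. *)
Definition sqnorm (R : realType) (X : hilbertType R) (x : X) : R :=
  complex.Re (`|x| ^+ 2).

Section SqNorm.
Variables (R : realType) (X : hilbertType R).
Implicit Types x y : X.

Lemma sqnormE x : `|x| ^+ 2 = (sqnorm x)%:C%C.
Proof. by rewrite RRe_real// ger0_real// exprn_ge0. Qed.

Lemma sqnorm_ge0 x : 0 <= sqnorm x.
Proof. by rewrite -lecR -sqnormE exprn_ge0. Qed.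

Lemma sqnorm_lt x (d : R) : 0 < d -> (`|x| < d%:C%C) = (sqnorm x < d ^+ 2).
Proof.
move=> d0; rewrite -(@ltr_pXn2r _ 2) ?nnegrE//; last by rewrite lecR ltW.
by rewrite sqnormE -rmorphXn ltcR.
Qed.

(** The parallelogram law for [x - y] and [x - z]; it makes distance-minimizing combinations
    Cauchy. *)
Lemma sqnorm_midpoint x y z :
  sqnorm (y - z) =
  (sqnorm (x - y) + sqnorm (x - z)) * 2
    - 4 * sqnorm (x - (2^-1 : R[i]) *: (y + z)).
Proof.
apply: complexI; rewrite rmorphB !rmorphM/= rmorphD/= -!sqnormE !rmorph_nat.
have := hparallelogram (x - y) (x - z).
have -> : x - y - (x - z) = - (y - z) by rewrite !opprB addrC subrKA.
have -> : x - y + (x - z) = (2 : R[i]) *: (x - (2^-1 : R[i]) *: (y + z)).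
  rewrite scalerBr scalerA divff ?pnatr_eq0// scale1r scaler_nat mulr2n opprD.
  by rewrite addrACA.
rewrite normrN normrZ normr_nat exprMn mulr_natr => <-.
ring.
Qed.

End SqNorm.

(** * Total families and isometries from Gram matrices *)

Section Density.
Variables (R : realType) (I : Type).

(** The formal combination [c] is kept apart from the family, so that one list can be evaluated in
    two spaces. *)
Definition lincomb (X : hilbertType R) (a : I -> X) (c : seq (R[i] * I)) : X :=
  \sum_(t <- c) t.1 *: a t.2.

Definition comb_scale (k : R[i]) (c : seq (R[i] * I)) :=
  [seq (k * t.1, t.2) | t <- c].

Definition total (X : hilbertType R) (a : I -> X) :=
  forall x, (forall i, '[x, a i] = 0) -> x = 0.

Lemma lincombP (X : hilbertType R) (a : I -> X) k c d :
  lincomb a (comb_scale k c ++ d) = k *: lincomb a c + lincomb a d.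
Proof.
rewrite /lincomb big_cat big_map scaler_sumr; congr (_ + _).
by apply: eq_bigr => t _; rewrite scalerA.
Qed.

Lemma lincomb1 (X : hilbertType R) (a : I -> X) k i :
  lincomb a [:: (k, i)] = k *: a i.
Proof. by rewrite /lincomb big_seq1. Qed.

(* The infimum of the distances to linear combinations is attained at a limit
   of linear combinations, which differs from x by a vector orthogonal to every
   a i. *)
Lemma total_dense (X : hilbertType R) (a : I -> X) (x : X) (e : R) :
  total a -> 0 < e -> exists c, `|x - lincomb a c| < e%:C%C.
Proof.
move=> a_total e0.
pose f c := sqnorm (x - lincomb a c).
pose d := inf (range f).
have lbf : has_lbound (range f) by exists 0 => _ [c _ <-]; exact: sqnorm_ge0.
have hi : has_inf (range f) by split=> //; exists (f [::]), [::].
have dle c : d <= f c by apply: ge_inf => //; exists c.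
pose B (r : R) : set X := [set lincomb a c | c in [set c | f c < d + r]].
have [r r0|r r' r0 rr'|r r0|p pP] := @nested_limit R X B.
- have [_ [c _ <-] cr] := inf_adherent r0 hi.
  by exists (lincomb a c), c.
- by move=> _ [c /= cr <-]; exists c => //=; apply: lt_le_trans cr _; rewrite lerD2l.
(* Two squared distances below [d + r ^+ 2 / 4] and a midpoint at squared distance at least [d]
   leave less than [r ^+ 2]. *)
- exists (r ^+ 2 / 4); first by rewrite divr_gt0// exprn_gt0.
  move=> _ _ [c /= cr <-] [c' /= cr' <-]; rewrite sqnorm_lt// (sqnorm_midpoint x).
  have := dle (comb_scale 2^-1 (comb_scale 1 c ++ c')).
  rewrite -(cats0 (comb_scale _ _)) /f lincombP lincombP scale1r.
  rewrite [lincomb a [::]]/lincomb big_nil addr0.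
  by move: cr cr'; rewrite /f; lra.
suff xp : x - p = 0.
  have [_ [c _ <-] pc] := pP 1 _ ltr01 e0.
  by exists c; move/subr0_eq: xp => ->.
apply: a_total => i; apply/eqP/normr0P.
(* With [y] a near-minimizer close to [p], the parts [x - y] and [p - y] each contribute at most [r]
   times the norm of [a i]. *)
apply: (@le_small_eq0 _ _ (`|a i| *+ 2)) => // [|r r0]; first by rewrite mulrn_wge0.
have r20 : 0 < r ^+ 2 by rewrite exprn_gt0.
have [_ [c /= cr <-]] := pP _ _ r20 r0.
set y := lincomb a c => py.
have -> : x - p = (x - y) - (p - y) by rewrite opprB addrA subrK.
rewrite hdotBl mulr2n mulrDr; apply: le_trans (ler_normB _ _) _.
apply: lerD; last first.
  by apply: le_trans (hCauchySchwarz _ _) _; rewrite ler_wpM2r// ltW.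
have [->|ai0] := eqVneq (a i) 0; first by rewrite hdot0r !normr0 mulr0.
have ni : 0 < `|a i| by rewrite normr_gt0.
have h s : sqnorm (x - y) - r ^+ 2 <= sqnorm (x - y - s *: a i).
  have := dle (comb_scale s [:: (1, i)] ++ c).
  rewrite /f lincombP lincomb1 scale1r -/y -addrA -opprD (addrC y).
  by move: cr; rewrite /f -/y; lra.
(* The projection coefficient of [w] on [a i] is the [s] that decreases the norm most. *)
move: (x - y) h => w /(_ ('[w, a i] / `|a i| ^+ 2)).
set s := _ / _; have sE : s * `|a i| ^+ 2 = '[w, a i].
  by rewrite divfK// expf_neq0// gt_eqF.
rewrite -lecR rmorphB/= -!sqnormE -!hdotE rmorphXn.
rewrite [in X in _ <= X]hdotBl !hdotBr !hdotZl !hdotZr (hdotC (a i) w) !hdotE.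
rewrite (mulrCA s) sE (mulrC s^*) opprB addrA addrNK.
rewrite lerBlDr -lerBlDl opprB addrCA subrr addr0 /s mulrAC -normCK.
rewrite -(@ler_pXn2r _ 2) ?nnegrE ?mulr_ge0// ?lecR ?(ltW r0)//.
by rewrite ler_pdivrMr ?exprn_gt0// -exprMn.
Qed.

End Density.

(** Equal Gram matrices give [lincomb a c] and [lincomb b c] the same norm, so sending the first to
    the second is well defined and isometric; density and completeness of [Y] extend it. *)
Lemma gram_isometry (R : realType) (I : Type) (X Y : hilbertType R)
    (a : I -> X) (b : I -> Y) :
  total a -> (forall i j, '[a i, a j] = '[b i, b j]) ->
  exists2 V : 'B(X, Y), isometric V & forall i, V (a i) = b i.
Proof.
move=> a_total gram.
have norm_ab c : `|lincomb a c| = `|lincomb b c|.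
  apply: hnorm_eq; rewrite /lincomb !hdot_suml; apply: eq_bigr => t _.
  rewrite !hdot_sumr; apply: eq_bigr => t' _.
  by rewrite !hdotZl !hdotZr gram.
have norm_abB c c' : `|lincomb a c - lincomb a c'| = `|lincomb b c - lincomb b c'|.
  have := norm_ab (comb_scale (-1) c' ++ c).
  by rewrite !lincombP !scaleN1r !(addrC (- _)).
(* The closure of the graph of this map, shown below to be the graph of a linear isometry. *)
pose ext x y := forall e : R, 0 < e ->
  exists c, `|x - lincomb a c| < e%:C%C /\ `|y - lincomb b c| < e%:C%C.
have ext_exists x : exists y, ext x y.
  pose B (r : R) : set Y :=
    [set lincomb b c | c in [set c | `|x - lincomb a c| < r%:C%C]].
  have [r r0|r r' r0 rr'|r r0|y yP] := @nested_limit R Y B.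
  - by have [c xc] := total_dense x a_total r0; exists (lincomb b c), c.
  - by move=> _ [c /= cr <-]; exists c => //=; apply: lt_le_trans cr _; rewrite lecR.
  - exists (r / 2); first by rewrite divr_gt0.
    move=> _ _ [c /= cr <-] [c' /= cr' <-]; rewrite -norm_abB.
    rewrite -(subrKA x) addrC; apply: le_lt_trans (ler_normD _ _) _.
    rewrite (splitr r) rmorphD; apply: ltrD => //.
    by rewrite distrC.
  - by exists y => e e0; have [_ [c /= xc <-] yc] := yP _ _ e0 e0; exists c.
have ext_norm x y : ext x y -> `|y| = `|x|.
  move=> xy; apply/subr0_eq/eqP; rewrite -normr_eq0; apply/eqP.
  apply: (@le_small_eq0 _ _ 2) => // e e0; have [c [xc yc]] := xy _ e0.
  have -> : `|y| - `|x| =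
      (`|y| - `|lincomb b c|) - (`|x| - `|lincomb a c|) by rewrite norm_ab; ring.
  rewrite mulr_natr mulr2n; apply: le_trans (ler_normB _ _) _.
  by apply: lerD; apply: le_trans (ler_dist_dist _ _) _; exact: ltW.
have ext_lin k x y x' y' : ext x y -> ext x' y' -> ext (k *: x + x') (k *: y + y').
  move=> xy xy' e e0.
  have kE : `|k| = (complex.Re `|k|)%:C%C by rewrite RRe_real ?normr_real.
  have k0 : 0 <= complex.Re `|k| by rewrite -lecR -kE normr_ge0.
  have k1 : 0 < complex.Re `|k| + 1 by rewrite ltr_wpDl.
  (* The [+ 1] covers [k = 0]. *)
  pose d := e / 2 / (complex.Re `|k| + 1).
  have d0 : 0 < d by rewrite !divr_gt0.
  have e20 : 0 < e / 2 by rewrite divr_gt0.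
  have [c [xc yc]] := xy _ d0; have [c' [xc' yc']] := xy' _ e20.
  have close (Z : hilbertType R) (f : I -> Z) u u' : `|u - lincomb f c| < d%:C%C ->
      `|u' - lincomb f c'| < (e / 2)%:C%C ->
      `|k *: u + u' - lincomb f (comb_scale k c ++ c')| < e%:C%C.
    move=> uc uc'; rewrite lincombP opprD addrACA -scalerBr.
    apply: le_lt_trans (ler_normD _ _) _; rewrite normrZ (splitr e) rmorphD/=.
    apply: ler_ltD => //; apply: le_trans (ler_wpM2l (normr_ge0 k) (ltW uc)) _.
    rewrite kE -rmorphM lecR /d mulrCA ger_pMr// ler_pdivrMr// mul1r lerDl.
    exact: ler01.
  by exists (comb_scale k c ++ c'); split; exact: close.
(* By linearity [y - y'] is related to [0], so its norm is [0]. *)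
have ext_uniq x y y' : ext x y -> ext x y' -> y = y'.
  move=> xy xy'; apply/eqP; rewrite -subr_eq0 -normr_eq0 addrC -scaleN1r.
  by rewrite (ext_norm _ _ (ext_lin (-1) _ _ _ _ xy' xy)) scaleN1r addNr normr0.
have [f fP] := choice ext_exists.
have L : linear f.
  by move=> k u v; apply: ext_uniq (fP _) _; exact: ext_lin.
pose V : {linear X -> Y} := lin_of L.
have Vnorm x : `|V x| = `|x| by exact: ext_norm (fP x).
have cV : continuous V by apply: (@bop_of_bound _ _ _ _ 1) => // x; rewrite mul1r Vnorm.
exists (Bop cV) => [|i]; first exact: Vnorm.
apply: (ext_uniq (a i)); first exact: fP.
by move=> e e0; exists [:: (1, i)]; rewrite !lincomb1 !scale1r !subrr !normr0 ltcR.
Qed.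

(** * Reproducing kernel spaces and lifting of isometries *)

Section KernelSpaces.
Variables (R : realType) (X : Type) (K : X -> X -> R[i]).

Lemma kernel_total (E : hilbertType R) (HE : rkhs E K) :
  total (fun p : X * E => rkhs_kernel HE p.1 p.2).
Proof.
move=> F F0; apply: rkhs_eval_inj => w; rewrite linear0.
apply/normr0_eq0/eqP; rewrite -sqrf_eq0 -hdotE -rkhs_reproducing.
exact/eqP/(F0 (w, _)).
Qed.

Lemma rkhs_lift (E E' : hilbertType R) (HE : rkhs E K) (HE' : rkhs E' K)
    (V : 'B(E, E')) : isometric V ->
  exists W : 'B(HE, HE'), forall F z, rkhs_eval z (W F) = V (rkhs_eval z F).
Proof.
move=> Vi.
have [|W _ Wk] := gram_isometry (b := fun p => rkhs_kernel HE' p.1 (V p.2))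
  (@kernel_total E HE).
  move=> [w eta] [z xi] /=; rewrite !rkhs_reproducing !rkhs_kernelE.
  by rewrite !hdotZl isometric_hdot.
(* Through the reproducing property, this action of [adj W] on kernels is the pointwise formula for
   [W]. *)
have adjWk z xi : adj W (rkhs_kernel HE' z xi) = rkhs_kernel HE z (adj V xi).
  apply: subr0_eq; apply: (@kernel_total E HE) => -[w eta] /=.
  rewrite hdotC hdotBr -adjP (Wk (w, eta)) /= !rkhs_reproducing !rkhs_kernelE.
  by rewrite !hdotZl -adjP subrr conjC0.
exists W => F z; apply: hdot_inj => xi.
rewrite hdotC -rkhs_reproducing adjP adjWk rkhs_reproducing -adjP.
by rewrite -hdotC.
Qed.

End KernelSpaces.

(** * Coordinate multiplication on the Drury-Arveson space *)

Section DruryArveson.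
Variables (R : realType) (n : nat).
Implicit Types z w : unit_ball R n.

(** The inner product has modulus below 1, by the arithmetic-geometric mean inequality in each
    coordinate. *)
Lemma ball_inner_neq1 z w : 1 - \sum_i z 0 i * (w 0 i)^* != 0.
Proof.
rewrite subr_eq0 eq_sym; apply/eqP => zw1.
suff : `|\sum_i z 0 i * (w 0 i)^*| < 1 by rewrite zw1 normr1 ltxx.
apply: le_lt_trans (ler_norm_sum _ _ _) _.
apply: (@le_lt_trans _ _ (\sum_i (`|z 0 i| ^+ 2 + `|w 0 i| ^+ 2) / 2)).
  apply: ler_sum => i _; rewrite normrM norm_conjC ler_pdivlMr// -subr_ge0.
  have -> : `|z 0 i| ^+ 2 + `|w 0 i| ^+ 2 - `|z 0 i| * `|w 0 i| * 2 =
    (`|z 0 i| - `|w 0 i|) ^+ 2 by ring.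
  by rewrite real_exprn_even_ge0// realB.
rewrite -mulr_suml big_split/= ltr_pdivrMr// mul1r.
by rewrite -[2]/(1 + 1); apply: ltrD; exact: ball_pointP.
Qed.

Fact ball0_subproof : \sum_i `|(0 : 'rV[R[i]]_n) 0 i| ^+ 2 < 1.
Proof. by rewrite big1// => i _; rewrite mxE normr0 expr0n. Qed.

Definition ball0 : unit_ball R n := UnitBall ball0_subproof.

Lemma da_kernel0 z : da_kernel z ball0 = 1.
Proof.
by rewrite /da_kernel big1 ?subr0 ?invr1// => i _; rewrite mxE conjC0 mulr0.
Qed.

Variables (E : hilbertType R) (HE : drury_arveson n E) (M : 'I_n -> 'B(HE)).
Hypothesis M_mult : forall i, coordinate_mult i (M i).

(** At [w] the left side multiplies the kernel by its own denominator, leaving the constant function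
    [eta], which is the kernel function at the origin. *)
Lemma coordinate_mult_kernel z (eta : E) :
  rkhs_kernel HE z eta - \sum_i (z 0 i)^* *: M i (rkhs_kernel HE z eta) =
  rkhs_kernel HE ball0 eta.
Proof.
apply: rkhs_eval_inj => w; rewrite linearB linear_sum.
under eq_bigr do rewrite linearZ_LR M_mult scalerA mulrC.
rewrite -scaler_suml rkhs_kernelE scalerA -scalerBl rkhs_kernelE da_kernel0.
congr (_ *: _); rewrite -{1}[da_kernel w z]mul1r -mulrBl.
by rewrite /da_kernel mulfV// ball_inner_neq1.
Qed.

Lemma coordinate_mult_adj (F : HE) z :
  rkhs_eval z F - \sum_i z 0 i *: rkhs_eval z (adj (M i) F) = rkhs_eval ball0 F.
Proof.
apply: hdot_inj => eta; rewrite hdotC [RHS]hdotC; congr (_^*).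
rewrite -[in RHS]rkhs_reproducing -(coordinate_mult_kernel z).
rewrite hdotBl hdotBr rkhs_reproducing hdot_suml hdot_sumr; congr (_ - _).
apply: eq_bigr => i _; rewrite hdotZl hdotZr conjCK -rkhs_reproducing.
by rewrite adjPr.
Qed.

(** The constant function with value [G] at the origin is [G - \sum_i M i (adj (M i) G)]; pair it
    with [F]. *)
Lemma coordinate_mult_dot0 (F G : HE) :
  '[rkhs_eval ball0 F, rkhs_eval ball0 G] =
  '[F, G] - \sum_i '[adj (M i) F, adj (M i) G].
Proof.
rewrite -rkhs_reproducing.
have -> : rkhs_kernel HE ball0 (rkhs_eval ball0 G) =
    G - \sum_i M i (adj (M i) G).
  apply: rkhs_eval_inj => z; rewrite rkhs_kernelE da_kernel0 scale1r.
  rewrite linearB linear_sum -(coordinate_mult_adj G z); congr (_ - _).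
  by apply: eq_bigr => i _; rewrite M_mult.
rewrite hdotBr hdot_sumr; congr (_ - _); apply: eq_bigr => i _.
by rewrite adjPr.
Qed.

End DruryArveson.

(* As rkhs_lift only lifts isometries, eta is normalized, so that c |-> c eta
   becomes one. *)
Lemma elementary_tensor_exists (R : realType) (n : nat)
    (Hs : drury_arveson n (hilbertC R)) (E : hilbertType R)
    (HE : drury_arveson n E) (f : Hs) (eta : E) :
  exists F : HE, elementary_tensor f eta F.
Proof.
have [->|eta0] := eqVneq eta 0.
  by exists (0 : HE) => z; rewrite linear0 scaler0.
have [e e1 etaE] : exists2 e, `|e| = 1 & eta = `|eta| *: e.
  exists (`|eta|^-1 *: eta); first by rewrite normrZ normfV normr_id mulVf// normr_eq0.
  by rewrite scalerA mulfV ?scale1r// normr_eq0.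
have L : linear (fun c : hilbertC R => (c : R[i]) *: e).
  by move=> a u v; rewrite scalerDl scalerA.
pose J : {linear hilbertC R -> E} := lin_of L.
have Jn c : `|J c| = `|c| by rewrite normrZ e1 mulr1.
have cJ : continuous J.
  by apply: (@bop_of_bound _ _ _ _ 1) => // c; rewrite mul1r Jn.
have [|W WE] := rkhs_lift Hs HE (V := Bop cJ); first exact: Jn.
exists (`|eta| *: W f) => z; rewrite linearZ_LR WE/= [in RHS]etaE.
by rewrite -[lin_of L _]/((rkhs_eval z f : R[i]) *: e) !scalerA mulrC.
Qed.

(** * The defect operator and its closed range *)

Section Defect.
Variables (R : realType) (n : nat) (H : hilbertType R) (T : 'I_n -> 'B(H)).

Lemma defect_form h k :
  '[defect T h, k] = '[h, k] - \sum_i '[adj (T i) h, adj (T i) k].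
Proof.
rewrite bopBE hdotBl bop_sumE hdot_suml; congr (_ - _).
by apply: eq_bigr => i _; exact: (adjP (T i)).
Qed.

(** If [x] were nonzero, some [A h] would lie closer to [x] than [0] does, against orthogonality and
    Cauchy-Schwarz. *)
Lemma cran_orthogonal_eq0 (K : hilbertType R) (A : 'B(H, K)) (x : cran A) :
  (forall h, '[cran_val x, A h] = 0) -> x = 0.
Proof.
move=> xA; apply/eqP; case: (eqVneq x 0) => // x0; exfalso.
have nx : 0 < `|cran_val x| by rewrite -cran_normE normr_gt0.
have := valP x; rewrite inE => /(_ _ (nbhsx_ballx _ _ nx)).
move=> [_ [[h _ <-]]]; rewrite -ball_normE/= => xh.
have : `|cran_val x| ^+ 2 < `|cran_val x| * `|cran_val x|.
  apply: le_lt_trans (_ : `|cran_val x| * `|cran_val x - A h| < _); last first.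
    by rewrite ltr_pM2l.
  apply: le_trans (hCauchySchwarz _ _).
  by rewrite hdotBr xA subr0 hdotE normrX normr_id.
by rewrite -expr2 ltxx.
Qed.

End Defect.

(** * The isometry [V] and the factorization *)

Theorem corollary3p3 (R : realType) (n : nat) (H E : hilbertType R)
    (T : 'I_n -> 'B(H))
    (H2 : drury_arveson n (hilbertC R))
    (H2c : drury_arveson n (defect_space T)) (H2E : drury_arveson n E)
    (Pic : 'B(H, H2c)) (Pi : 'B(H, H2E)) :
  commuting_tuple T -> row_contraction T -> pure_tuple T ->
  canonical_dilation Pic -> dilation T Pi ->
  exists2 V : 'B(defect_space T, E), isometric V &
    exists2 W : 'B(H2c, H2E), id_tensor H2 V W & Pi = W \Bo Pic.
Proof.
move=> _ _ _ [D [D0 DD] PicE] [Pi_iso Pi_adj].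
have [M M_mult M_Pi] : exists2 M : 'I_n -> 'B(H2E),
    (forall i, coordinate_mult i (M i)) &
    forall i, adj (M i) \Bo Pi = Pi \Bo adj (T i).
  have /choice[M MP] i : exists M : 'B(H2E),
      coordinate_mult i M /\ adj M \Bo Pi = Pi \Bo adj (T i).
    by have [M] := Pi_adj i; exists M.
  by exists M => i; case: (MP i).
have adjM_Pi i h : adj (M i) (Pi h) = Pi (adj (T i) h).
  exact: (congr1 (fun A : 'B(H, H2E) => A h) (M_Pi i)).
have Dsa := bop_ge0_selfadjoint D0.
have DDE h : D (D h) = defect T h by rewrite -DD.
pose a h := rkhs_eval (ball0 R n) (Pic h).
pose b h := rkhs_eval (ball0 R n) (Pi h).
(* At the origin the resolvent [Q] is the identity. *)
have aE h : cran_val (a h) = D h.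
  have [Q [_ +] ->] := PicE (ball0 R n).
  rewrite big1 ?subr0 => [Q1|i _]; last by rewrite mxE scale0r.
  by congr (D _); exact: (congr1 (fun A : 'B(H) => A h) Q1).
(* [defect T h] is the value [a (D h)], and such vectors are dense in [defect_space T]. *)
have a_total : total a.
  move=> x xa; apply: (@cran_orthogonal_eq0 _ _ _ (defect T)) => h.
  by rewrite -DDE -aE; exact: xa.
have gram h k : '[a h, a k] = '[b h, b k].
  rewrite -[LHS]/('[cran_val (a h), cran_val (a k)]) !aE -Dsa DDE defect_form.
  rewrite (coordinate_mult_dot0 M_mult) (isometric_hdot Pi_iso); congr (_ - _).
  by apply: eq_bigr => i _; rewrite !adjM_Pi (isometric_hdot Pi_iso).
have [V V_iso Va] := gram_isometry a_total gram.
have [W WE] := rkhs_lift H2c H2E V_iso.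
exists V => //; exists W => [f eta|].
  have [F FE] := elementary_tensor_exists H2c f eta.
  by exists F => // z; rewrite WE FE linearZ_LR.
apply: bopP => h; apply: rkhs_eval_inj => z; rewrite /= WE.
have [Q [Q1 _] PicQ] := PicE z.
have PicV : rkhs_eval z (Pic h) = a (Q h) by apply: val_inj; rewrite /= PicQ aE.
rewrite PicV Va /b -(coordinate_mult_adj M_mult _ z).
(* Only the [h] on the left is expanded through the resolvent; [coordinate_mult_adj] has already
   turned [b (Q h)] into the matching difference at [z]. *)
have {1}-> : h = Q h - \sum_i z 0 i *: adj (T i) (Q h).
  by rewrite -[LHS]/(\1 h) -Q1 -[LHS]/(_ (Q h)) bopBE bop_sumE.
rewrite linearB linear_sum linearB linear_sum; congr (_ - _).
by apply: eq_bigr => i _; rewrite !linearZ_LR adjM_Pi.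
Qed.
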